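(* Let $n\ge2$. The set of catalan triangles of order $n$, ordered by coordinatewise comparison, forms a distributive lattice $\mathbf{Cat}_n$, whose poset of join irreducible elements is isomorphic to the poset of quadruples $(x_1,x_2,x_3,x_4)\in\mathbb{N}^4$ with $x_1+x_2+x_3+x_4=n-3$, ordered by $\mathbf{x}\le\mathbf{y}$ if and only if $x_2+x_3+x_4\le y_2+y_3+y_4$, $x_2+x_4\le y_2+y_4$, $x_3+x_4\le y_3+y_4$ and $x_4\le y_4$.
   Context: $\mathcal{D}_n$ is the set of triples $(y_1,y_2,y_3)\in\mathbb{N}^3$ with $y_1+y_2+y_3=n-2$. A catalan triangle of order $n$ is a map $\gamma:\mathcal{D}_n\to\mathbb{N}$ such that $\gamma(i,0,n-2-i)=i+1$ for all $0\le i\le n-2$ and, for all $(y_1,y_2,y_3)\in\mathcal{D}_n$ with $y_2\ge1$, $\gamma(y_1,y_2-1,y_3+1)\le\gamma(y_1,y_2,y_3)\le\gamma(y_1+1,y_2-1,y_3)$, $\ \gamma(y_1,y_2,y_3)-\gamma(y_1,y_2-1,y_3+1)\le1$ and $\gamma(y_1+1,y_2-1,y_3)-\gamma(y_1,y_2,y_3)\le1$. An element of a finite lattice is join irreducible if it covers exactly one element; the join irreducible elements carry the induced order. For $n=2$ the set of quadruples is empty. *)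

(* Defs.v *)
From HB Require Import structures.
From mathcomp Require Import all_boot all_order.
From mathcomp Require Import zify.

Set Implicit Arguments.
Unset Strict Implicit.
Unset Printing Implicit Defensive.

(* The bound 'I_n is implied by the equation on the sum: it only serves to
   make the type finite, so that maps on it have decidable equality. *)
Record triple (n : nat) : Type := Triple {
  tr_val : 'I_n * 'I_n * 'I_n;
  _ : tr_val.1.1 + tr_val.1.2 + tr_val.2 + 2 == n
}.
HB.instance Definition _ (n : nat) := [isSub for @tr_val n].
HB.instance Definition _ (n : nat) := [Finite of triple n by <:].

Definition tr1 (n : nat) (y : triple n) : nat := (tr_val y).1.1.
Definition tr2 (n : nat) (y : triple n) : nat := (tr_val y).1.2.
Definition tr3 (n : nat) (y : triple n) : nat := (tr_val y).2.

(* a = (y1, y2 - 1, y3 + 1), with y2 >= 1 *)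
Definition lower_nbr (n : nat) (a y : triple n) : bool :=
  [&& tr1 a == tr1 y, tr2 a + 1 == tr2 y & tr3 a == tr3 y + 1].

(* b = (y1 + 1, y2 - 1, y3), with y2 >= 1 *)
Definition upper_nbr (n : nat) (b y : triple n) : bool :=
  [&& tr1 b == tr1 y + 1, tr2 b + 1 == tr2 y & tr3 b == tr3 y].

Definition is_catalan (n : nat) (g : {ffun triple n -> nat}) : bool :=
  [forall y, (tr2 y == 0) ==> (g y == tr1 y + 1)] &&
  [forall y, forall a, forall b, lower_nbr a y && upper_nbr b y ==>
    [&& g a <= g y, g y <= g b, g y - g a <= 1 & g b - g y <= 1]].

Record catalan (n : nat) : Type := Catalan {
  cat_val :> {ffun triple n -> nat};
  _ : is_catalan cat_val
}.
HB.instance Definition _ (n : nat) := [isSub for @cat_val n].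
HB.instance Definition _ (n : nat) := [Choice of catalan n by <:].

Definition catalan_le (n : nat) (g h : catalan n) : bool :=
  [forall y, g y <= h y].

Section JoinIrreducible.

Variables (d : Order.disp_t) (L : finLatticeType d).

Definition covers (x y : L) : bool :=
  (y < x)%O && ~~ [exists z : L, (y < z)%O && (z < x)%O].

Definition join_irreducible (x : L) : bool :=
  #|[set y : L | covers x y]| == 1.

Record join_irr : Type := JoinIrr {
  ji_val : L;
  _ : join_irreducible ji_val
}.
HB.instance Definition _ := [isSub for ji_val].
HB.instance Definition _ := [Finite of join_irr by <:].
HB.instance Definition _ := [SubChoice_isSubPOrder of join_irr by <: with d].

End JoinIrreducible.

(* Written with an addition: for n = 2 the type is empty, which truncated
   subtraction n - 3 would miss. *)
Record quad (n : nat) : Type := Quad {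
  qd_val : nat * nat * nat * nat;
  _ : qd_val.1.1.1 + qd_val.1.1.2 + qd_val.1.2 + qd_val.2 + 3 == n
}.
HB.instance Definition _ (n : nat) := [isSub for @qd_val n].
HB.instance Definition _ (n : nat) := [Choice of quad n by <:].

Section QuadOrder.

Variable n : nat.

Definition qd1 (x : quad n) : nat := (qd_val x).1.1.1.
Definition qd2 (x : quad n) : nat := (qd_val x).1.1.2.
Definition qd3 (x : quad n) : nat := (qd_val x).1.2.
Definition qd4 (x : quad n) : nat := (qd_val x).2.

Definition quad_le (x y : quad n) : bool :=
  [&& qd2 x + qd3 x + qd4 x <= qd2 y + qd3 y + qd4 y,
      qd2 x + qd4 x <= qd2 y + qd4 y,
      qd3 x + qd4 x <= qd3 y + qd4 y
    & qd4 x <= qd4 y].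

Fact quad_le_refl : reflexive quad_le.
Proof. by move=> x; rewrite /quad_le !leqnn. Qed.

Fact quad_le_anti : antisymmetric quad_le.
Proof.
move=> [[[[x1 x2] x3] x4] /= px] [[[[y1 y2] y3] y4] /= py] /andP[].
rewrite /quad_le /qd2 /qd3 /qd4 /= => /and4P[? ? ? ?] /and4P[? ? ? ?].
by apply: val_inj; congr (_, _, _, _) => /=; lia.
Qed.

Fact quad_le_trans : transitive quad_le.
Proof.
move=> y x z /and4P[? ? ? ?] /and4P[? ? ? ?].
by apply/and4P; split; lia.
Qed.

HB.instance Definition _ := Order.Le_isPOrder.Build (Order.Disp tt tt) (quad n)
  quad_le_refl quad_le_anti quad_le_trans.

End QuadOrder.

(* Main.v *)
(* Subtracting its minimal value y1 + 1 turns a catalan triangle into a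
   function h of (y1, y3) that vanishes on y1 + y3 = n - 2 and decreases by 0
   or 1 along each of the two axes.  Equivalently h satisfies the asymmetric
   Lipschitz condition h(y) <= h(x) + max(0, x1 - y1) + max(0, x3 - y3), which
   is stable under pointwise minima and maxima.  Hence for 1 <= t <= y2 there
   is a least triangle with h(y) >= t, namely
   x |-> max(0, t - max(0, x1 - y1) - max(0, x3 - y3)).
   These are the join irreducible elements, and the one given by (y, t)
   corresponds to the quadruple (y2 - t, y1, y3, t - 1). *)
Require Import Defs.
From HB Require Import structures.
From mathcomp Require Import all_boot all_order.
From mathcomp Require Import zify.

Set Implicit Arguments.
Unset Strict Implicit.
Unset Printing Implicit Defensive.

Import Order.Theory.

(** * Join irreducibles of a finite lattice: a greatest element strictly below *)

Section FiniteLattice.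

Variables (d : Order.disp_t) (L : finLatticeType d).

(** Anything covered by x lies below m, and cannot lie strictly below it because m would then sit in
    between. *)
Lemma join_irreducible_of_max_below (x m : L) :
  (m < x)%O -> (forall z : L, (z < x)%O -> (z <= m)%O) -> join_irreducible x.
Proof.
move=> mx max_m; apply/cards1P; exists m; apply/setP => y.
rewrite !inE /covers; apply/andP/eqP => [[yx /existsPn noz]|->]; last first.
  split=> //; apply/existsPn => z; apply/negP => /andP[mz zx].
  by have := lt_le_trans mz (max_m z zx); rewrite ltxx.
have := max_m y yx; rewrite le_eqVlt => /predU1P[//|ym].
by have := noz m; rewrite ym mx.
Qed.

Lemma exists_cover_above (x z : L) :
  (z < x)%O -> exists2 w : L, covers x w & (z <= w)%O.
Proof.
move=> zx; pose P w := (z <= w)%O && (w < x)%O.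
have Pz : P z by rewrite /P lexx.
(* The size of the down-set serves as a strictly increasing rank: an element between w and x would
   have a larger one. *)
case: (arg_maxnP (fun w : L => #|[set v : L | (v <= w)%O]|) Pz).
move=> w /andP[zw wx] max_w; exists w => //.
rewrite /covers wx; apply/existsPn => v; apply/negP => /andP[wv vx].
have := max_w v; rewrite /P vx (le_trans zw (ltW wv)) => /(_ isT).
apply/negP; rewrite -ltnNge; apply: proper_card; apply/properP; split.
  by apply/subsetP => u; rewrite !inE => uw; apply: le_trans uw (ltW wv).
by exists v; rewrite !inE ?lexx // lt_geF.
Qed.

Lemma join_irreducible_max_below (x : L) : join_irreducible x ->
  exists2 m : L, (m < x)%O & forall z : L, (z < x)%O -> (z <= m)%O.
Proof.
move=> /cards1P[m mE]; exists m.
  by have : m \in [set m] := set11 m; rewrite -mE inE => /andP[].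
move=> z /exists_cover_above[w wx zw].
by have : w \in [set m]; [rewrite -mE inE | rewrite inE => /eqP<-].
Qed.

End FiniteLattice.

(** * Catalan triangles as asymmetric Lipschitz functions *)

Section Triples.

Variable n : nat.
Implicit Types x y : triple n.

Lemma tr_sum y : tr1 y + tr2 y + tr3 y + 2 = n.
Proof. by case: y => p pP; apply/eqP. Qed.

Lemma triple_eq x y : tr1 x = tr1 y -> tr3 x = tr3 y -> x = y.
Proof.
move=> e1 e3; have e2 : tr2 x = tr2 y by have := tr_sum x; have := tr_sum y; lia.
case: x y e1 e2 e3 => [[[a b] c] px] [[[a' b'] c'] py].
rewrite /tr1 /tr2 /tr3 /= => e1 e2 e3.
by apply: val_inj; congr (_, _, _); apply: val_inj.
Qed.

Lemma triple_at (a b c : nat) : a + b + c + 2 = n ->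
  exists y, [/\ tr1 y = a, tr2 y = b & tr3 y = c].
Proof.
move=> abc.
have an : a < n by lia.
have bn : b < n by lia.
have cn : c < n by lia.
have abcP : (Ordinal an, Ordinal bn, Ordinal cn).1.1
    + (Ordinal an, Ordinal bn, Ordinal cn).1.2
    + (Ordinal an, Ordinal bn, Ordinal cn).2 + 2 == n by apply/eqP.
by exists (Triple abcP).
Qed.

(** The Lipschitz condition on h, restated for g = h + y1 + 1; this shift reverses the truncated
    difference of first coordinates. *)
Definition lipschitz (g : triple n -> nat) : Prop :=
  forall x y, g y <= g x + (tr1 y - tr1 x) + (tr3 x - tr3 y).

Section CatalanLipschitz.

Variable g : {ffun triple n -> nat}.
Hypothesis gP : is_catalan g.

Lemma catalan_lower_nbr x y : lower_nbr x y -> g x <= g y <= g x + 1.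
Proof.
move=> xy; have /andP[_ /forallP/(_ y)/forallP/(_ x)/forallP step] := gP.
have /and3P[/eqP e1 /eqP e2 /eqP e3] := xy.
(* [is_catalan] constrains both neighbours of y jointly, so the other one must be exhibited; it
   exists because y2 >= 1. *)
have [|z [z1 z2 z3]] := @triple_at (tr1 y + 1) (tr2 x) (tr3 y).
  by have := tr_sum y; lia.
have := step z; rewrite xy /upper_nbr z1 z2 z3 e2 !eqxx /= => /and4P[*].
by apply/andP; split; lia.
Qed.

Lemma catalan_upper_nbr x y : upper_nbr x y -> g y <= g x <= g y + 1.
Proof.
move=> xy; have /andP[_ /forallP/(_ y)/forallP step] := gP.
have /and3P[/eqP e1 /eqP e2 /eqP e3] := xy.
have [|z [z1 z2 z3]] := @triple_at (tr1 y) (tr2 x) (tr3 y + 1).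
  by have := tr_sum y; lia.
have /forallP/(_ x) := step z.
rewrite xy /lower_nbr z1 z2 z3 e2 !eqxx /= => /and4P[*].
by apply/andP; split; lia.
Qed.

(* Walk from y to x, decreasing coordinates before increasing them so as to
   stay inside the triangle. *)
Lemma catalan_lipschitz : lipschitz g.
Proof.
move=> x y; move dE : ((tr1 y - tr1 x) + (tr1 x - tr1 y)
  + (tr3 y - tr3 x) + (tr3 x - tr3 y)) => k.
elim: k y dE => [|k IHk] y dE.
  by rewrite (@triple_eq x y) //; lia.
have sy := tr_sum y; have sx := tr_sum x.
case: (ltnP (tr1 x) (tr1 y)) => h1.
  have [|z [z1 z2 z3]] := @triple_at (tr1 y - 1) (tr2 y + 1) (tr3 y); first lia.
  have := IHk z; rewrite z1 z3 => /(_ ltac:(lia)).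
  have /catalan_upper_nbr : upper_nbr y z by apply/and3P; split; lia.
  by move=> /andP[]; lia.
case: (ltnP (tr3 x) (tr3 y)) => h3.
  have [|z [z1 z2 z3]] := @triple_at (tr1 y) (tr2 y + 1) (tr3 y - 1); first lia.
  have := IHk z; rewrite z1 z3 => /(_ ltac:(lia)).
  have /catalan_lower_nbr : lower_nbr y z by apply/and3P; split; lia.
  by move=> /andP[]; lia.
(* From here neither outer coordinate of y exceeds that of x, and they are not both equal, so y2 >=
   1 and there is room to increase one. *)
case: (ltnP (tr1 y) (tr1 x)) => h1'.
  have [|z [z1 z2 z3]] := @triple_at (tr1 y + 1) (tr2 y - 1) (tr3 y); first lia.
  have := IHk z; rewrite z1 z3 => /(_ ltac:(lia)).
  have /catalan_upper_nbr : upper_nbr z y by apply/and3P; split; lia.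
  by move=> /andP[]; lia.
have [|z [z1 z2 z3]] := @triple_at (tr1 y) (tr2 y - 1) (tr3 y + 1); first lia.
have := IHk z; rewrite z1 z3 => /(_ ltac:(lia)).
have /catalan_lower_nbr : lower_nbr z y by apply/and3P; split; lia.
by move=> /andP[]; lia.
Qed.

Lemma catalan_base y : tr2 y = 0 -> g y = tr1 y + 1.
Proof.
by move=> y2; have /andP[/forallP/(_ y) + _] := gP; rewrite y2 => /eqP.
Qed.

End CatalanLipschitz.

(** The four inequalities are the Lipschitz condition between y and each neighbour, in both
    directions. *)
Lemma is_catalan_of_lipschitz (g : triple n -> nat) :
  (forall y, tr2 y = 0 -> g y = tr1 y + 1) -> lipschitz g ->
  is_catalan [ffun y => g y].
Proof.
move=> g0 gl; apply/andP; split.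
  by apply/forallP => y; apply/implyP => /eqP/g0; rewrite ffunE => ->.
apply/forallP => y; apply/forallP => a; apply/forallP => b; apply/implyP.
move=> /andP[/and3P[/eqP a1 /eqP a2 /eqP a3] /and3P[/eqP b1 /eqP b2 /eqP b3]].
rewrite !ffunE.
have := gl a y; have := gl y a; have := gl b y; have := gl y b.
by move=> *; apply/and4P; split; lia.
Qed.

(** * Bounds on the values, and finiteness *)

Lemma catalan_ge (g : catalan n) y : tr1 y + 1 <= g y.
Proof.
have sy := tr_sum y.
(* x is the boundary point with the same first coordinate, where the value is prescribed. *)
have [|x [x1 x2 x3]] := @triple_at (tr1 y) 0 (tr3 y + tr2 y); first lia.
have := catalan_lipschitz (valP g) y x; have := catalan_base (valP g) x2.
by rewrite /=; lia.
Qed.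

Lemma catalan_le_top (g : catalan n) y : g y <= tr1 y + tr2 y + 1.
Proof.
have sy := tr_sum y.
have [|x [x1 x2 x3]] := @triple_at (tr1 y) 0 (tr3 y + tr2 y); first lia.
have := catalan_lipschitz (valP g) x y; have := catalan_base (valP g) x2.
by rewrite /=; lia.
Qed.

Lemma catalan_lt (g : catalan n) y : g y < n.
Proof. by have := catalan_le_top g y; have := tr_sum y; lia. Qed.

Definition catalan_enc (g : catalan n) : {ffun triple n -> 'I_n} :=
  [ffun y => Ordinal (catalan_lt g y)].

Definition catalan_dec (f : {ffun triple n -> 'I_n}) : option (catalan n) :=
  insub [ffun y => f y : nat].

Lemma catalan_encK : pcancel catalan_enc catalan_dec.
Proof.
move=> g; rewrite /catalan_dec.
suff -> : [ffun y => catalan_enc g y : nat] = val g by rewrite valK.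
by apply/ffunP => y; rewrite !ffunE.
Qed.

HB.instance Definition _ : isCountable (catalan n) := PCanIsCountable catalan_encK.
HB.instance Definition _ : isFinite (catalan n) := PCanIsFinite catalan_encK.

(** * The bounded distributive lattice of catalan triangles *)

Fact catalan_le_refl : reflexive (@catalan_le n).
Proof. by move=> g; apply/forallP => y. Qed.

Fact catalan_le_anti : antisymmetric (@catalan_le n).
Proof.
move=> g h /andP[/forallP gh /forallP hg].
by apply: val_inj; apply/ffunP => y; apply/eqP; rewrite eqn_leq gh hg.
Qed.

Fact catalan_le_trans : transitive (@catalan_le n).
Proof.
move=> h g k /forallP gh /forallP hk.
by apply/forallP => y; apply: leq_trans (gh y) (hk y).
Qed.

HB.instance Definition _ := Order.Le_isPOrder.Build (Order.Disp tt tt)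
  (catalan n) catalan_le_refl catalan_le_anti catalan_le_trans.

Fact catalan_min_subproof (g h : catalan n) :
  is_catalan [ffun y => minn (g y) (h y)].
Proof.
apply: is_catalan_of_lipschitz => [y y0|x y].
  by rewrite (catalan_base (valP g)) ?(catalan_base (valP h)) ?minnn.
have := catalan_lipschitz (valP g) x y; have := catalan_lipschitz (valP h) x y.
by rewrite /=; lia.
Qed.

Fact catalan_max_subproof (g h : catalan n) :
  is_catalan [ffun y => maxn (g y) (h y)].
Proof.
apply: is_catalan_of_lipschitz => [y y0|x y].
  by rewrite (catalan_base (valP g)) ?(catalan_base (valP h)) ?maxnn.
have := catalan_lipschitz (valP g) x y; have := catalan_lipschitz (valP h) x y.
by rewrite /=; lia.
Qed.

Definition catalan_min g h := Catalan (catalan_min_subproof g h).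
Definition catalan_max g h := Catalan (catalan_max_subproof g h).

Fact catalan_minP (g h k : catalan n) :
  (g <= catalan_min h k)%O = (g <= h)%O && (g <= k)%O.
Proof.
apply/forallP/andP => [gP|[/forallP gh /forallP gk] y].
  by split; apply/forallP => y; have := gP y; rewrite ffunE leq_min => /andP[].
by rewrite ffunE leq_min gh gk.
Qed.

Fact catalan_maxP (g h k : catalan n) :
  (catalan_max g h <= k)%O = (g <= k)%O && (h <= k)%O.
Proof.
apply/forallP/andP => [gP|[/forallP gk /forallP hk] y].
  by split; apply/forallP => y; have := gP y; rewrite ffunE geq_max => /andP[].
by rewrite ffunE geq_max gk hk.
Qed.

HB.instance Definition _ := Order.POrder_MeetJoin_isLattice.Build
  (Order.Disp tt tt) (catalan n) catalan_minP catalan_maxP.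

Fact catalan_meetUl :
  @left_distributive (catalan n) (catalan n) Order.meet Order.join.
Proof.
move=> g h k; apply: val_inj; apply/ffunP => y.
by rewrite !ffunE minn_maxl.
Qed.

HB.instance Definition _ := Order.Lattice_Meet_isDistrLattice.Build
  (Order.Disp tt tt) (catalan n) catalan_meetUl.

Fact catalan_bot_subproof : is_catalan [ffun y : triple n => tr1 y + 1].
Proof. by apply: is_catalan_of_lipschitz => // x y; lia. Qed.

Fact catalan_top_subproof : is_catalan [ffun y : triple n => tr1 y + tr2 y + 1].
Proof.
apply: is_catalan_of_lipschitz => [y ->|x y]; first by rewrite addn0.
by have := tr_sum x; have := tr_sum y; lia.
Qed.

Definition catalan_bot := Catalan catalan_bot_subproof.
Definition catalan_top := Catalan catalan_top_subproof.

Fact catalan_le0x (g : catalan n) : (catalan_bot <= g)%O.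
Proof. by apply/forallP => y; rewrite ffunE catalan_ge. Qed.

Fact catalan_lex1 (g : catalan n) : (g <= catalan_top)%O.
Proof. by apply/forallP => y; rewrite ffunE catalan_le_top. Qed.

HB.instance Definition _ := Order.hasBottom.Build
  (Order.Disp tt tt) (catalan n) catalan_le0x.
HB.instance Definition _ := Order.hasTop.Build
  (Order.Disp tt tt) (catalan n) catalan_lex1.

(** * Quadruples as join irreducible triangles *)

Implicit Types q r : quad n.

Lemma qd_sum q : qd1 q + qd2 q + qd3 q + qd4 q + 3 = n.
Proof. by case: q => p pP; apply/eqP. Qed.

Lemma quad_at (a b c e : nat) : a + b + c + e + 3 = n ->
  exists q, [/\ qd1 q = a, qd2 q = b, qd3 q = c & qd4 q = e].
Proof.
move=> /eqP abce; pose v := (a, b, c, e).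
have vP : v.1.1.1 + v.1.1.2 + v.1.2 + v.2 + 3 == n by [].
by exists (Quad vP).
Qed.

Fact quad_catalan_subproof q : is_catalan [ffun y : triple n =>
  tr1 y + 1 + ((qd4 q).+1 - ((tr1 y - qd2 q) + (tr3 y - qd3 q)))].
Proof.
apply: is_catalan_of_lipschitz => [y y2|x y].
  (* If y2 = 0 then y1 + y3 = x1 + x2 + x3 + x4 + 1 for q = (x1, x2, x3, x4), so the two differences
     add up to at least x4 + 1. *)
  by have := tr_sum y; have := qd_sum q; lia.
by have := tr_sum x; have := tr_sum y; have := qd_sum q; lia.
Qed.

Definition quad_catalan q : catalan n := Catalan (quad_catalan_subproof q).

Lemma quad_catalanE q y : quad_catalan q y =
  tr1 y + 1 + ((qd4 q).+1 - ((tr1 y - qd2 q) + (tr3 y - qd3 q))).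
Proof. by rewrite ffunE. Qed.

(** The bound is the value of [quad_catalan q] at its base point y. The Lipschitz condition carries
    it from y to every x, and [catalan_ge] covers the points where the truncated term is 0. *)
Lemma quad_catalan_le q (g : catalan n) y : tr1 y = qd2 q -> tr3 y = qd3 q ->
  (quad_catalan q <= g)%O = (qd2 q + qd4 q + 2 <= g y).
Proof.
move=> y1 y3; apply/forallP/idP => [/(_ y)|gy x].
  by rewrite quad_catalanE; lia.
have := catalan_lipschitz (valP g) x y; have := catalan_ge g x.
by rewrite quad_catalanE /=; lia.
Qed.

Lemma quad_triple q : exists y : triple n, tr1 y = qd2 q /\ tr3 y = qd3 q.
Proof.
have [|y [y1 _ y3]] := @triple_at (qd2 q) (qd1 q + qd4 q + 1) (qd3 q).
  by have := qd_sum q; lia.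
by exists y.
Qed.

(** Tested at the base point of q, the comparison reads q4 + max(0, q2 - r2) + max(0, q3 - r3) <=
    r4; expanding the two maxima gives the four inequalities of the order. *)
Lemma quad_catalan_mono q r : (quad_catalan q <= quad_catalan r)%O = (q <= r)%O.
Proof.
have [y [y1 y3]] := quad_triple q.
rewrite (quad_catalan_le _ y1 y3) quad_catalanE y1 y3.
by apply/idP/and4P => [?|[? ? ? ?]]; first split; lia.
Qed.

Lemma quad_catalan_inj : injective quad_catalan.
Proof. by move=> q r qr; apply/le_anti; rewrite -!quad_catalan_mono qr lexx. Qed.

(* The triangles strictly below [quad_catalan q] are those below it with a
   smaller value at the base point of q, a join-stable condition. *)
Lemma quad_catalan_join_irreducible q : join_irreducible (quad_catalan q).
Proof.
have [y [y1 y3]] := quad_triple q.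
set J := quad_catalan q.
have yJ : J y = qd2 q + qd4 q + 2 by rewrite quad_catalanE; lia.
have ltJ z : (z < J)%O -> z y < J y.
  by move=> zJ; rewrite ltnNge yJ -(quad_catalan_le _ y1 y3) lt_geF.
pose m : catalan n := (\join_(z | (z < J)%O) z)%O.
have mJ : (m <= J)%O by apply/joinsP => z /ltW.
have my : m y < J y.
  (* The empty join is the bottom triangle, with value y1 + 1 at y. *)
  apply: (big_ind (fun z : catalan n => z y < J y)) => [|g h gy hy|z /ltJ//].
    by rewrite yJ ffunE y1; lia.
  by rewrite ffunE gtn_max gy hy.
apply: (@join_irreducible_of_max_below _ _ _ m) => [|z zJ].
  by rewrite lt_neqAle mJ andbT; apply: contraTneq my => ->; rewrite ltnn.
exact: joins_sup.
Qed.

(** Let m be the greatest element strictly below g, and y a point where m is smaller than g. The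
    least triangle reaching [g y] at y is below g but not below m, hence equals g. *)
Lemma join_irreducible_quad_catalan (g : catalan n) :
  join_irreducible g -> exists q, g == quad_catalan q.
Proof.
move=> /join_irreducible_max_below[m mg max_m].
have /forallPn[y] : ~~ catalan_le g m by apply/negP => /(lt_le_trans mg); rewrite ltxx.
rewrite -ltnNge => mgy.
have my := catalan_ge m y; have gy := catalan_le_top g y; have sy := tr_sum y.
(* This is (y2 - t, y1, y3, t - 1) with t = g(y) - y1 - 1; here t >= 1 since g(y) > m(y) >= y1 +
   1. *)
have [|q [q1 q2 q3 q4]] := @quad_at (tr1 y + tr2 y + 1 - g y) (tr1 y) (tr3 y)
  (g y - tr1 y - 2); first lia.
exists q; rewrite eq_sym; apply: contraT => Jg.
have Jle h : (quad_catalan q <= h)%O = (g y <= h y).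
  by rewrite (@quad_catalan_le _ _ y) ?q2 ?q3 // q4; congr (_ <= _); lia.
have := max_m (quad_catalan q); rewrite lt_neqAle Jg !Jle leqnn => /(_ isT).
by rewrite leqNgt mgy.
Qed.

End Triples.

Theorem proposition4p21 (n : nat) (hn : 2 <= n) :
  exists c : Order.FinTBDistrLattice (Order.Disp tt tt) (catalan n),
    let Cat : finTBDistrLatticeType (Order.Disp tt tt) :=
      Order.FinTBDistrLattice.Pack c in
    (forall g h : Cat, (g <= h)%O = catalan_le g h) /\
    exists f : join_irr Cat -> quad n,
      bijective f /\ (forall x y : join_irr Cat, (f x <= f y)%O = (x <= y)%O).
Proof.
exists (Order.FinTBDistrLattice.on (catalan n)) => Cat; split=> //.
(* f picks a preimage under [quad_catalan], unique by injectivity, so the order embedding of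
   [quad_catalan] transfers to f. *)
pose f (x : join_irr Cat) := xchoose (join_irreducible_quad_catalan (valP x)).
have fE x : quad_catalan (f x) = val x.
  by rewrite -(eqP (xchooseP (join_irreducible_quad_catalan (valP x)))).
exists f; split.
  exists (fun q => JoinIrr (quad_catalan_join_irreducible q)) => [x|q].
    by apply: val_inj; rewrite /= fE.
  by apply: quad_catalan_inj; rewrite fE.
by move=> x y; rewrite -quad_catalan_mono !fE.
Qed.
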